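(* Let $X\in\mathcal{X}\subseteq\mathbb{R}$ and $Y\in\mathcal{Y}\subseteq\mathbb{R}$ be random variables such that the conditional pdf of $Y$ given $X$ has the univariate exponential family form $$f_{Y|X}(y|x) = h(y)\, e^{x T(y) - \phi(x)}, \qquad y\in\mathcal{Y},\ x\in\mathcal{X},$$ and assume the regularity conditions (R) listed in the context. Let $F_\ell(y) = \mathbb{E}[X^\ell|Y=y]$. Then, for all integers $\ell\ge 1$ and all $y\in\mathcal{Y}$ with $T'(y)\neq 0$, $$F_{\ell+1}(y) = \frac{1}{T'(y)} F_\ell'(y) + F_1(y) F_\ell(y).$$
   Context: Exponential family: $T:\mathcal{Y}\to\mathbb{R}$ is the sufficient statistic, $\phi:\mathcal{X}\to\mathbb{R}$ the log-partition function, $h:\mathcal{Y}\to[0,\infty)$ the base measure. Standing assumptions: $\mathcal{Y}$ is open, $h$ is absolutely continuous with respect to Lebesgue measure, and $T$ is analytic (with $T'$ having only isolated zeros). Regularity conditions (R): for every integer $\ell\ge1$ and $U=X^\ell$: $\mathbb{E}[|U| \mid Y=y]<\infty$, $\mathbb{E}[|U|\,|X| \mid Y=y]<\infty$ and $\mathbb{E}[|X| \mid Y=y]<\infty$ for all $y\in\mathcal{Y}$; and $y\mapsto x^\ell\,\iota_{P_{X,Y}}(x;y)$ and $y\mapsto f_{Y|X}(y|x)$ are absolutely continuous for every $x$. Here $\iota_{P_{X,Y}}(x;y) = \log\frac{f_{Y|X}(y|x)}{f_Y(y)}$ is the information density, with $f_Y$ the marginal pdf of $Y$. *)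

(* Defs.v *)
(* MathComp world, with MathComp-Analysis *)
From HB Require Import structures.
From mathcomp Require Import all_boot all_order all_algebra.
From mathcomp Require Import all_classical all_reals all_analysis.
Import Order.TTheory GRing.Theory Num.Theory.
Import numFieldNormedType.Exports.

Set Implicit Arguments.
Unset Strict Implicit.
Unset Printing Implicit Defensive.

Local Open Scope classical_set_scope.
Local Open Scope ring_scope.

Definition real_analytic_on {R : realType} (D : set R) (g : R -> R) : Prop :=
  forall y0, D y0 -> exists (a : R^nat) (r : R), 0 < r /\
    forall y, `|y - y0| < r -> pseries a (y - y0) @ \oo --> g y.

Definition abs_continuous_itv {R : realType} (c d : R) (g : R -> R) : Prop :=
  forall e : R, 0 < e -> exists2 delta : R, 0 < delta &
    forall (n : nat) (a b : 'I_n -> R),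
      (forall i, c <= a i /\ a i <= b i /\ b i <= d) ->
      trivIset setT (fun i => [set` `]a i, b i[]) ->
      \sum_(i < n) (b i - a i) < delta ->
      \sum_(i < n) `|g (b i) - g (a i)| < e.

(* On a (possibly unbounded) open set, absolute continuity is meant on every
   compact interval: y |-> y ^+ 2 is absolutely continuous on setT. *)
Definition abs_continuous_on {R : realType} (D : set R) (g : R -> R) : Prop :=
  forall c d : R, [set` `[c, d]] `<=` D -> abs_continuous_itv c d g.

(* Conditional densities are written [f y x] for f_{Y|X}(y|x); only the values
   for y in calY and x in calX matter. *)
Definition exp_family {R : realType} (h T phi : R -> R) (y x : R) : R :=
  h y * expR (x * T y - phi x).

Section conditional_density.
Local Open Scope ereal_scope.
Context {R : realType} {d : measure_display} {Omega : measurableType d}.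
Variables (P : probability Omega R) (X Y : {RV P >-> R}).
Variables (calX calY : set R) (f : R -> R -> R).
Let mu := @lebesgue_measure R.

(* The outer integral runs over Omega rather than against the law of X, so that
   no measurability of calX is needed. *)
Definition is_conditional_pdf : Prop :=
  [/\ forall x, calX x -> measurable_fun calY (f ^~ x),
      forall x y, calX x -> calY y -> (0 <= f y x)%R,
      forall x, calX x -> \int[mu]_(y in calY) (f y x)%:E = 1 &
      forall A B : set R, measurable A -> measurable B ->
        P (X @^-1` A `&` Y @^-1` B) =
        \int[P]_(w in X @^-1` A) \int[mu]_(y in B `&` calY) (f y (X w))%:E].

Definition marginal_pdf (y : R) : \bar R := 'E_P[fun w => f y (X w)].

(* E[g(X) | Y = y], in the version given for every y by Bayes' formula:
   the law of X given Y = y has density f_{Y|X}(y|.) / f_Y(y) with respect to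
   the law of X. *)
Definition cond_expectation (g : R -> R) (y : R) : \bar R :=
  'E_P[fun w => (g (X w) * f y (X w))%R] / marginal_pdf y.

Definition cond_moment (l : nat) (y : R) : R :=
  fine (cond_expectation (fun x => x ^+ l)%R y).

(* In \bar R this is finite exactly when 0 < f_{Y|X}(y|x) and
   0 < f_Y(y) < +oo; in particular 0 / 0 = 0 and lne 0 = -oo. *)
Definition info_density (x y : R) : \bar R :=
  lne ((f y x)%:E / marginal_pdf y).

(* The information density is a real-valued function on calX x calY; this
   finiteness is what makes conditioning on Y = y meaningful at every y in
   calY. *)
Definition regularity : Prop :=
  (forall x y, calX x -> calY y -> info_density x y \is a fin_num) /\
  forall l : nat, (1 <= l)%N ->
    (forall y, calY y ->
      [/\ cond_expectation (fun x => `|x ^+ l|)%R y < +oo,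
          cond_expectation (fun x => `|x ^+ l| * `|x|)%R y < +oo &
          cond_expectation (fun x => `|x|)%R y < +oo]) /\
    (forall x, calX x ->
      abs_continuous_on calY (fun y => x ^+ l * fine (info_density x y))%R /\
      abs_continuous_on calY (f ^~ x)).

End conditional_density.

(* Main.v *)
(* With [k = expR (- phi X)] and G_l(t) = E[X^l e^(tX) k], Bayes' formula gives
   F_l = (G_l / G_0) o T, because h(y) cancels. Differentiating under the
   integral sign gives G_l' = G_(l+1), so the quotient rule yields
   F_l' = T' (F_(l+1) - F_1 F_l). The domination needs no analysis of the domain
   of G_l: as T'(y) <> 0, T takes values a < T(y) < b on calY, and regularity
   says that every |X|^l e^(aX) k and |X|^l e^(bX) k is integrable. *)
Require Import Defs.
From HB Require Import structures.
From mathcomp Require Import all_boot all_order all_algebra.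
From mathcomp Require Import all_classical all_reals all_analysis.
From mathcomp Require Import measurable_realfun lra ring.
Import Order.TTheory GRing.Theory Num.Theory.
Import numFieldNormedType.Exports.
Local Open Scope classical_set_scope.
Local Open Scope ring_scope.

(** * Differentiation of tilted moments under the integral sign *)

Section tilted_moments.
Context {R : realType} {d : measure_display} {Omega : measurableType d}.
Variables (P : {measure set Omega -> \bar R}) (X k : Omega -> R).
Hypothesis X_meas : measurable_fun setT X.
Hypothesis k_meas : measurable_fun setT k.
Hypothesis k_ge0 : forall w, 0 <= k w.

Definition tilt (l : nat) (t : R) (w : Omega) : R :=
  X w ^+ l * expR (t * X w) * k w.

Definition tilted_moment (l : nat) (t : R) : R := \int[P]_w tilt l t w.

(** All exponents are required at once because differentiating in the tilting parameter raises the
    exponent by one. *)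
Definition all_tilts_integrable (t : R) : Prop :=
  forall l, P.-integrable setT (EFin \o tilt l t).

Lemma measurable_tilt l t : measurable_fun setT (tilt l t).
Proof.
apply: measurable_funM => //; apply: measurable_funM.
  exact: measurable_funX.
by apply: measurableT_comp => //; exact: measurable_funM.
Qed.

Lemma norm_tilt l t w : `|tilt l t w| = `|X w| ^+ l * expR (t * X w) * k w.
Proof.
by rewrite !normrM normrX (ger0_norm (expR_ge0 _)) (ger0_norm (k_ge0 _)).
Qed.

(** For fixed [w] the norm is monotone in [t], in a direction given by the sign of [X w], so one
    endpoint already dominates; the sum makes the bound uniform in [w]. *)
Lemma norm_tilt_le l a b t w : a <= t <= b ->
  `|tilt l t w| <= `|tilt l a w| + `|tilt l b w|.
Proof.
move=> /andP[a_le_t t_le_b]; rewrite !norm_tilt -mulrDl -mulrDr.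
rewrite ler_wpM2r// ler_wpM2l ?exprn_ge0//.
have [X_ge0|X_lt0] := leP 0 (X w).
- by rewrite ler_wpDl ?expR_ge0// ler_expR ler_wpM2r.
- by rewrite ler_wpDr ?expR_ge0// ler_expR ler_wnM2r// ltW.
Qed.

Lemma integrable_norm_tiltD l a b :
  all_tilts_integrable a -> all_tilts_integrable b ->
  P.-integrable setT (fun w => (`|tilt l a w| + `|tilt l b w|)%:E).
Proof.
move=> int_a int_b; under eq_fun do rewrite EFinD.
apply: integrableD => //.
- exact: (integrable_abse (int_a l)).
- exact: (integrable_abse (int_b l)).
Qed.

Lemma all_tilts_integrable_itv a b t :
  a <= t <= b -> all_tilts_integrable a -> all_tilts_integrable b ->
  all_tilts_integrable t.
Proof.
move=> atb int_a int_b l.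
apply: (le_integrable measurableT _ _
  (integrable_norm_tiltD l _ _ int_a int_b)).
- by apply/measurable_EFinP; exact: measurable_tilt.
- move=> w _ /=; rewrite lee_fin [leRHS]ger0_norm ?addr_ge0//.
  exact: norm_tilt_le.
Qed.

Lemma is_derive_tilt l (t : R) w : is_derive t 1 ((tilt l)^~ w) (tilt l.+1 t w).
Proof.
rewrite /tilt.
have -> : (fun s => X w ^+ l * expR (s * X w) * k w) =
    (X w ^+ l * k w) *: (expR \o (X w *: (id : R -> R))).
  by apply/funext => s; rewrite /= !fctE /GRing.scale/= mulrAC [s * _]mulrC.
apply: is_derive_eq.
rewrite -[(X w *: id) t]/(X w * t) /GRing.scale/= mulr1 exprS [X w * t]mulrC.
by ring.
Qed.

(* On ]a, b[ the derivative of the integrand in the tilting parameter is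
   dominated by the sum of its values at the two endpoints, since exp is
   monotone. *)
Lemma is_derive_tilted_moment l (a b t : R) : a < t < b ->
  all_tilts_integrable a -> all_tilts_integrable b ->
  is_derive t 1 (tilted_moment l) (tilted_moment l.+1 t).
Proof.
move=> atb int_a int_b.
have partialE s w : partial1of2 (tilt l) s w = tilt l.+1 s w.
  by rewrite partial1of2E; apply: derive_val; exact: is_derive_tilt.
have int_itv s : `]a, b[%classic s -> P.-integrable setT (EFin \o tilt l s).
  rewrite /= in_itv/= => /andP[/ltW as_ /ltW sb].
  by apply: (all_tilts_integrable_itv a b); rewrite ?as_.
have t_in : `]a, b[%classic t by rewrite /= in_itv.
have der s w : `]a, b[%classic s -> setT w -> derivable ((tilt l)^~ w) s 1.
  by move=> _ _; case: (is_derive_tilt l s w).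
pose G w := `|tilt l.+1 a w| + `|tilt l.+1 b w|.
have G_ge0 w : 0 <= G w by rewrite addr_ge0.
have int_G : P.-integrable setT (EFin \o G) by exact: integrable_norm_tiltD.
have G_ub s w : `]a, b[%classic s -> setT w ->
    `|partial1of2 (tilt l) s w| <= G w.
  rewrite /= in_itv/= => /andP[/ltW as_ /ltW sb] _.
  by rewrite partialE; apply: norm_tilt_le; rewrite as_.
have dF :=
  derivable_under_integral measurableT t_in int_itv der G_ge0 int_G G_ub.
have eF :=
  differentiation_under_integral measurableT t_in int_itv der G_ge0 int_G G_ub.
apply: DeriveDef; first exact: dF.
rewrite -derive1E eF.
by apply: eq_Rintegral => w _; rewrite partialE.
Qed.

End tilted_moments.

(** * Measurability of the log-partition function along [X] *)

Section partition_function.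
Context {R : realType}.
Variables (calX calY : set R) (h T phi : R -> R).
Let mu := @lebesgue_measure R.
Hypothesis calY_meas : measurable calY.
Hypothesis h_gt0 : forall y, calY y -> 0 < h y.
Hypothesis h_meas : measurable_fun calY h.
Hypothesis pdf_meas :
  forall x, calX x -> measurable_fun calY ((exp_family h T phi)^~ x).
Hypothesis pdf_int1 : forall x, calX x ->
  (\int[mu]_(y in calY) (exp_family h T phi y x)%:E = 1)%E.

Definition partition_fun (x : R) : \bar R :=
  (\int[mu]_(y in calY) (h y * expR (x * T y))%:E)%E.

(** The logarithm of the density at [x] is [ln (h y) + x * T y - phi x], which can be solved for
    [T y] as [x] is nonzero. *)
Lemma measurable_sufficient_statistic x :
  calX x -> x != 0 -> measurable_fun calY T.
Proof.
move=> calXx x_neq0.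
pose logf := @ln R \o (exp_family h T phi)^~ x.
apply: (@eq_measurable_fun _ _ _ _ _
  (fun y => x^-1 * (logf y - (@ln R \o h) y + phi x))).
  move=> y; rewrite inE => /h_gt0 hy_gt0.
  rewrite /logf /= /exp_family lnM ?posrE ?expR_gt0// expRK.
  by field.
apply: measurable_funM => //; apply: measurable_funD => //.
by apply: measurable_funB; apply: measurableT_comp => //; exact: pdf_meas.
Qed.

Lemma measurable_partition_fun :
  measurable_fun calY T -> measurable_fun setT partition_fun.
Proof.
move=> T_meas.
(* Extending [h] and [T] by zero off [calY] gives a nonnegative, jointly measurable integrand on the
   whole plane, to which Tonelli applies. *)
pose g (xy : R * R) : \bar R :=
  ((h \_ calY) xy.2 * expR (xy.1 * (T \_ calY) xy.2))%:E.
have -> : partition_fun = fubini_F mu g.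
  apply/funext => x; rewrite /partition_fun /fubini_F [LHS]integral_mkcond.
  apply: eq_integral => y _; rewrite /g /= !patchE.
  by case: ifPn => //; rewrite mul0r.
apply: measurable_fun_fubini_tonelli_F; last first.
  move=> xy; rewrite lee_fin mulr_ge0 ?expR_ge0//.
  by rewrite patchE; case: ifPn => //; rewrite inE => /h_gt0/ltW.
have h_patch : measurable_fun setT (h \_ calY).
  exact: (measurable_restrictT h calY_meas).1.
have T_patch : measurable_fun setT (T \_ calY).
  exact: (measurable_restrictT T calY_meas).1.
apply/measurable_EFinP; apply: measurable_funM.
  exact: (measurableT_comp h_patch).
apply: measurableT_comp => //; apply: measurable_funM => //.
exact: (measurableT_comp T_patch).
Qed.

Lemma partition_funE x : measurable_fun calY T -> calX x ->
  partition_fun x = (expR (phi x))%:E.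
Proof.
move=> T_meas calXx.
have : ((expR (- phi x))%:E * partition_fun x = 1)%E.
  rewrite -(pdf_int1 x calXx) -ge0_integralZl_EFin//.
  - apply: eq_integral => y _; rewrite -EFinM /exp_family expRD; congr EFin.
    by ring.
  - by move=> y /h_gt0/ltW ?; rewrite lee_fin mulr_ge0 ?expR_ge0.
  - apply/measurable_EFinP; apply: measurable_funM => //.
    by apply: measurableT_comp => //; exact: measurable_funM.
move/(congr1 (mule (expR (phi x))%:E)).
by rewrite muleA -EFinM expRN divff ?gt_eqF ?expR_gt0// mul1e mule1.
Qed.

(* [phi] itself is an arbitrary function off [calX]; on [calX] it is the
   logarithm of the partition function because densities integrate to 1. If
   [calX] is contained in {0}, then [T] cannot be recovered from the densities
   but [phi \o X] is constant. *)
Lemma measurable_log_partition {d : measure_display}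
    {Omega : measurableType d} (X : Omega -> R) :
  measurable_fun setT X -> (forall w, calX (X w)) ->
  measurable_fun setT (phi \o X).
Proof.
move=> X_meas X_in.
have [[x [calXx x_neq0]]|calX0] := pselect (exists x, calX x /\ x != 0).
  have T_meas := measurable_sufficient_statistic x calXx x_neq0.
  have -> : phi \o X = (@ln R \o fine) \o (partition_fun \o X).
    by apply/funext => w; rewrite /= partition_funE// expRK.
  apply: measurableT_comp; first exact: measurableT_comp.
  by apply: measurableT_comp => //; exact: measurable_partition_fun.
have -> : phi \o X = cst (phi 0).
  apply/funext => w /=; congr phi; apply/eqP; apply: contra_notT calX0 => Xw.
  by exists (X w).
exact: measurable_cst.
Qed.

End partition_function.

(* [derive1] is a limit, hence the junk value 0 when the limit does not exist. *)
Lemma derivable_derive1_neq0 {R : realType} (g : R -> R) (y : R) :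
  derive1 g y != 0 -> derivable g y 1.
Proof.
rewrite derive1E /derive => /eqP; apply: contra_notP => /dvgP.
exact.
Qed.

(** Close to [y], difference quotients on both sides have the sign of the derivative. Applied to
    [T], this supplies the two tilts that dominate a neighbourhood of [T y]. *)
Lemma derive1_neq0_straddle {R : realType} (D : set R) (g : R -> R) (y : R) :
  nbhs y D -> derive1 g y != 0 ->
  exists a b, [/\ D a, D b & g a < g y < g b].
Proof.
move=> nbhsD g'_neq0.
(* The extra factor makes the limit a square, hence positive whatever the sign of the derivative. *)
pose q e := derive1 g y * (e^-1 * (g (e + y) - g y)).
have q_cvg : q e @[e --> 0^'] --> derive1 g y * derive1 g y.
  apply: cvgMr; rewrite /derive1.
  have := derivable_derive1_neq0 g y g'_neq0.
  rewrite /derivable /=.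
  by under eq_fun do rewrite /= scaler1.
have sqr_gt0 : 0 < derive1 g y * derive1 g y.
  by rewrite -expr2 exprn_even_gt0.
have : \forall e \near 0^', 0 < q e /\ D (e + y).
  near=> e; split; near: e; first exact: (cvgr_gt _ q_cvg).
  apply: cvg_within.
  have : e + y @[e --> (0 : R)] --> 0 + y by apply: cvgD => //; exact: cvg_cst.
  by rewrite add0r; exact.
rewrite near_withinE => /nbhs_ballP[r /= r_gt0 ball_r].
(* The ball is open, so its points at distance [r / 2] on either side of the centre are used. *)
have close e : `|e| = r / 2 -> 0 < q e /\ D (e + y).
  move=> er; apply: ball_r; first by rewrite /ball/= sub0r normrN er; lra.
  by rewrite -normr_gt0 er divr_gt0.
have r2_gt0 : 0 < r / 2 by rewrite divr_gt0.
have [] := close (r / 2); first by rewrite gtr0_norm.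
have [] := close (- (r / 2)); first by rewrite normrN gtr0_norm.
rewrite /q invrN mulNr mulrN oppr_gt0.
rewrite [X in X < 0]mulrCA [X in 0 < X -> _]mulrCA.
rewrite pmulr_rlt0 ?invr_gt0// pmulr_rgt0 ?invr_gt0//.
move=> qm Dm qp Dp.
(* The sign of the derivative decides which of the two points carries the smaller value. *)
have [g'_lt0|g'_gt0|g'_eq0] := ltgtP (derive1 g y) 0; last first.
- by rewrite g'_eq0 eqxx in g'_neq0.
- exists (- (r / 2) + y), (r / 2 + y); split => //.
  by rewrite -subr_lt0 -(pmulr_rlt0 _ g'_gt0) qm
    -subr_gt0 -(pmulr_rgt0 _ g'_gt0).
- exists (r / 2 + y), (- (r / 2) + y); split => //.
  by rewrite -subr_lt0 -(nmulr_rgt0 _ g'_lt0) qp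
    -subr_gt0 -(nmulr_rlt0 _ g'_lt0).
Unshelve. all: by end_near. Qed.

(** * Conditional moments as ratios of tilted moments *)

Section conditional_moments.
Context {R : realType} {d : measure_display} {Omega : measurableType d}.
Variables (P : probability Omega R) (X : {RV P >-> R}).

(** With [0^-1 = +oo] and [+oo^-1 = 0], each excluded value sends the ratio to 0 or [+oo], where
    [lne] is infinite. *)
Lemma info_density_fin_num (f : R -> R -> R) x y :
  0 <= f y x -> (0 <= marginal_pdf X f y)%E ->
  info_density X f x y \is a fin_num ->
  0 < f y x /\ (0 < marginal_pdf X f y < +oo)%E.
Proof.
rewrite /info_density; set m := marginal_pdf X f y => f_ge0 m_ge0 fin.
have f_gt0 : 0 < f y x.
  rewrite lt_neqAle f_ge0 andbT eq_sym; apply: contraTneq fin => ->.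
  by rewrite mul0e le0_lneNy.
split => //; apply/andP; split.
- rewrite lt_neqAle m_ge0 andbT eq_sym; apply: contraTneq fin => ->.
  by rewrite inve0 gt0_muley ?lte_fin.
- rewrite ltey; apply: contraTneq fin => ->.
  by rewrite invey mule0 le0_lneNy.
Qed.

Variables (h T phi : R -> R).
Hypothesis phiX_meas : measurable_fun setT (phi \o X).
Let f := exp_family h T phi.
Let k w := expR (- phi (X w)).

Let X_meas : measurable_fun setT X.
Proof. exact: measurable_funPT. Qed.

Let k_meas : measurable_fun setT k.
Proof. by apply: measurableT_comp => //; exact: measurable_funN. Qed.

Let k_ge0 w : 0 <= k w. Proof. exact: expR_ge0. Qed.

Lemma exp_family_tilt l y w :
  X w ^+ l * f y (X w) = h y * tilt X k l (T y) w.
Proof.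
by rewrite /f /exp_family /tilt /k expRD [X w * _]mulrC; ring.
Qed.

Lemma exp_family_norm_tilt l y w : 0 < h y ->
  `|X w ^+ l| * f y (X w) = h y * `|tilt X k l (T y) w|.
Proof.
move=> h_gt0; rewrite -[in RHS](gtr0_norm h_gt0) -normrM -exp_family_tilt.
by rewrite normrM [`|f _ _|]ger0_norm// mulr_ge0 ?expR_ge0// ltW.
Qed.

Lemma all_tilts_integrable_exp_family y : 0 < h y ->
  (forall l, ('E_P[fun w => (`|X w ^+ l| * f y (X w))%R] < +oo)%E) ->
  all_tilts_integrable P X k (T y).
Proof.
move=> h_gt0 E_fin l; apply/integrableP; split.
  by apply/measurable_EFinP; exact: measurable_tilt.
have := E_fin l; rewrite unlock /=.
under eq_integral do rewrite exp_family_norm_tilt// EFinM.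
rewrite ge0_integralZl_EFin ?(ltW h_gt0)//; last first.
  apply/measurable_EFinP; apply: measurableT_comp => //.
  exact: measurable_tilt.
(* An infinite integral of the tilt would stay infinite after multiplication by [h y > 0]. *)
rewrite !ltey; apply: contra => /eqP ->.
by rewrite gt0_muley ?lte_fin.
Qed.

Lemma expectation_exp_family l y : all_tilts_integrable P X k (T y) ->
  'E_P[fun w => (X w ^+ l * f y (X w))%R]%E =
  (h y * tilted_moment P X k l (T y))%:E.
Proof.
move=> int_y; rewrite unlock /=.
under eq_integral do rewrite exp_family_tilt EFinM.
rewrite integralZl//; last exact: int_y.
by rewrite EFinM fineK//; exact: (integrable_fin_num measurableT (int_y l)).
Qed.

Lemma marginal_pdf_exp_family y : all_tilts_integrable P X k (T y) ->
  marginal_pdf X f y = (h y * tilted_moment P X k 0 (T y))%:E.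
Proof.
move=> int_y; rewrite -expectation_exp_family// /marginal_pdf.
by congr expectation; apply/funext => w; rewrite expr0 mul1r.
Qed.

Lemma cond_moment_exp_family l y :
  0 < h y -> all_tilts_integrable P X k (T y) ->
  tilted_moment P X k 0 (T y) != 0 ->
  cond_moment X f l y =
  tilted_moment P X k l (T y) / tilted_moment P X k 0 (T y).
Proof.
move=> h_gt0 int_y m0_neq0; rewrite /cond_moment /cond_expectation.
rewrite expectation_exp_family// marginal_pdf_exp_family// inver.
rewrite mulf_eq0 gt_eqF//= (negbTE m0_neq0) /=.
by field; rewrite m0_neq0 gt_eqF.
Qed.

End conditional_moments.

Theorem proposition2 (R : realType) (d : measure_display)
    (Omega : measurableType d) (P : probability Omega R)
    (X Y : {RV P >-> R}) (calX calY : set R) (h T phi : R -> R)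
    (X_in : forall w, calX (X w))
    (Y_in : forall w, calY (Y w))
    (calY_open : open calY)
    (h_ge0 : forall y, calY y -> 0 <= h y)
    (h_meas : measurable_fun calY h)
    (h_ac : (fun B : set R =>
        (\int[@lebesgue_measure R]_(y in B `&` calY) (h y)%:E)%E)
      `<< @lebesgue_measure R)
    (T_analytic : real_analytic_on calY T)
    (T'_isolated_zeros : forall y, calY y -> derive1 T y = 0 ->
      \forall z \near y^', derive1 T z != 0)
    (cond_pdf : is_conditional_pdf X Y calX calY (exp_family h T phi))
    (reg : regularity X calX calY (exp_family h T phi)) :
  let F := cond_moment X (exp_family h T phi) in
  forall (l : nat) (y : R), (1 <= l)%N -> calY y -> derive1 T y != 0 ->
    derivable (F l) y 1 /\
    F l.+1 y = (derive1 T y)^-1 * derive1 (F l) y + F 1%N y * F l y.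
Proof.
case: cond_pdf => pdf_meas pdf_ge0 pdf_int1 _; case: reg => info_fin moments.
set f := exp_family h T phi in pdf_meas pdf_ge0 pdf_int1 info_fin moments *.
have m_ge0 y : calY y -> (0 <= marginal_pdf X f y)%E.
  move=> Yy; rewrite /marginal_pdf unlock; apply: integral_ge0 => w _.
  by rewrite lee_fin pdf_ge0.
(* [Omega] is pointed, so [X point] is an element of [calX] at which finiteness of the information
   density can be read off. *)
have f_m_gt0 y : calY y ->
    0 < f y (X point) /\ (0 < marginal_pdf X f y < +oo)%E.
  move=> Yy; apply: info_density_fin_num; [exact: pdf_ge0|exact: m_ge0|].
  exact: info_fin.
have h_gt0 y : calY y -> 0 < h y.
  by move=> /f_m_gt0[+ _]; rewrite /f /exp_family pmulr_lgt0 ?expR_gt0.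
have phiX_meas : measurable_fun setT (phi \o X).
  apply: (measurable_log_partition calX calY h T) => //.
  exact: open_measurable.
pose k w := expR (- phi (X w)).
have int_T y : calY y -> all_tilts_integrable P X k (T y).
  move=> Yy; apply: (all_tilts_integrable_exp_family P X h) => //.
    exact: h_gt0.
  have [_ /andP[m_gt0 m_lty]] := f_m_gt0 y Yy.
  (* The moment conditions start at exponent 1; for exponent 0 the integral is the marginal density,
     already known to be finite. *)
  case=> [|l].
    move: m_lty; rewrite /marginal_pdf; congr (_ < _)%E.
    by congr expectation; apply/funext => w; rewrite expr0 normr1 mul1r.
  have [/(_ y Yy)[+ _ _] _] := moments l.+1 isT.
  (* The marginal density is positive and finite, so an infinite numerator would make the
     conditional expectation infinite. *)
  rewrite /cond_expectation !ltey; apply: contra => /eqP ->.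
  by rewrite gt0_mulye// inve_gt0 ?m_gt0// ?(gt_eqF m_gt0)// (lt_eqF m_lty).
pose G := tilted_moment P X k.
have G0_gt0 y : calY y -> 0 < G 0 (T y).
  move=> Yy; have [_ /andP[+ _]] := f_m_gt0 y Yy.
  rewrite marginal_pdf_exp_family//; last exact: int_T.
  by rewrite lte_fin pmulr_rgt0 ?h_gt0.
have FE l y : calY y -> cond_moment X f l y = G l (T y) / G 0 (T y).
  move=> Yy; apply: cond_moment_exp_family => //; first exact: h_gt0.
    exact: int_T.
  by rewrite gt_eqF// G0_gt0.
move=> F l y _ Yy T'_neq0.
have nbhsY : nbhs y calY by exact: open_nbhs_nbhs.
have [a [b [Ya Yb ayb]]] := derive1_neq0_straddle calY T y nbhsY T'_neq0.
have dT : is_derive y 1 T (derive1 T y).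
  rewrite derive1E; apply: DeriveDef => //; exact: derivable_derive1_neq0.
have dG n : is_derive y 1 (G n \o T) (G n.+1 (T y) * derive1 T y).
  apply: is_derive1_comp.
  apply: (is_derive_tilted_moment _ _ _ _ _ _ _ (T a) (T b)) => //.
  - by apply: measurableT_comp => //; exact: measurable_funN.
  - by move=> w; exact: expR_ge0.
  - exact: int_T.
  - exact: int_T.
have G0_neq0 : G 0 (T y) != 0 by rewrite gt_eqF// G0_gt0.
have dF : is_derive y 1 (F l) (derive1 T y * (F l.+1 y - F 1%N y * F l y)).
  have dV : is_derive y 1 (fun z => (G 0 (T z))^-1)
      (- (G 0 (T y)) ^- 2 *: (G 1 (T y) * derive1 T y)).
    exact: (is_deriveV (f := G 0 \o T)).
  have dQ := is_deriveM (dG l) dV.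
  (* The quotient formula for [F l] is known only on [calY]; this suffices because [calY] is a
     neighbourhood of [y]. *)
  apply: (near_eq_is_derive (f := (G l \o T) * (fun z => (G 0 (T z))^-1))).
    by near=> z; rewrite /F FE//; near: z.
  apply: is_derive_eq; rewrite /F !FE// /GRing.scale/=.
  by field.
split; first by case: dF.
by rewrite (derive1E (F l)) (@derive_val _ _ _ _ _ _ _ dF); field.
Unshelve. all: by end_near. Qed.
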